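(* Let $m\geq 2$ be an integer and let $b_m(n)$ denote the $m$-ary partition function. Then there exists $N$ such that $b_m(a)b_m(b)>b_m(a+b)$ for all integers $a,b\geq N$.
   Context: For an integer $m\geq 2$ and $n\in\mathbb{N}$ (non-negative integers), $b_m(n)$ is the number of partitions of $n$ into parts from the set $\{m^i: i\in\mathbb{N}\}$, i.e. the number of ways to write $n$ as a sum of powers of $m$ (order of summands disregarded), with $b_m(0)=1$. Equivalently, $\sum_{n\ge0} b_m(n)x^n=\prod_{i\ge0}(1-x^{m^i})^{-1}$. *)

(* Defs.v *)
From mathcomp Require Import all_boot.

Set Implicit Arguments.
Unset Strict Implicit.
Unset Printing Implicit Defensive.

(* A partition of n into powers of m >= 2 is encoded by its multiplicities:
   c i is the number of parts equal to m ^ i, so that n is the sum of the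
   c i * m ^ i.  The bounds i <= n and c i <= n only serve to make the type of
   multiplicity functions finite; mary_mult_bounded shows that they exclude
   nothing when m >= 2. *)
Definition mary_partitions (m n : nat) : {set {ffun 'I_n.+1 -> 'I_n.+1}} :=
  [set c : {ffun 'I_n.+1 -> 'I_n.+1} | \sum_(i < n.+1) c i * m ^ i == n].

Definition mary (m n : nat) : nat := #|mary_partitions m n|.

Lemma mary_mult_bounded (m n K : nat) (c : nat -> nat) :
  1 < m -> \sum_(i < K) c i * m ^ i = n ->
  forall i, i < K -> 0 < c i -> i <= n /\ c i <= n.
Proof.
move=> m1 <- i iK ci; rewrite (bigD1 (Ordinal iK)) //=.
have mi : 0 < m ^ i by rewrite expn_gt0 (ltnW m1).
split; apply: leq_trans (leq_addr _ _).
- by apply: leq_trans (ltnW (ltn_expl i m1)) _; rewrite leq_pmull.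
- by rewrite leq_pmulr.
Qed.

Lemma mary0 (m : nat) : mary m 0 = 1.
Proof.
apply: etrans (cards1 ([ffun=> ord0] : {ffun 'I_1 -> 'I_1})).
apply: eq_card => c; rewrite !inE big_ord1 /= ord1 mul0n eqxx.
by apply/esym/eqP/ffunP => i; rewrite ffunE !ord1.
Qed.

(* Main.v *)
Require Import Defs.
From mathcomp Require Import all_boot.
From mathcomp Require Import zify.

Set Implicit Arguments.
Unset Strict Implicit.
Unset Printing Implicit Defensive.

(** Removing the parts equal to 1 and dividing the others by m gives
    b(n) = \sum_(j <= n %/ m) b(j).  For a <= b the sums for b(a + b) and b(b)
    therefore differ by at most a %/ m + 1 terms, each of index at most
    (a + b) %/ m <= b, whence b(a + b) <= (a %/ m + 2) b(b).  On the other hand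
    b(j) >= 2 for j >= m, so the recurrence gives
    b(a) >= 2 (a %/ m + 1) - m, which exceeds a %/ m + 2 once a %/ m > m. *)

Lemma big_ord_widen0 (j n : nat) (F : nat -> nat) :
  j <= n -> (forall i, j <= i < n -> F i = 0) ->
  \sum_(i < n) F i = \sum_(i < j) F i.
Proof.
move=> jn F0; rewrite (big_ord_widen n F jn) [RHS]big_mkcond /=.
by apply: eq_bigr => i _; case: ltnP => // ji; rewrite F0 // ji ltn_ord.
Qed.

Lemma sum_ord_shift (m n : nat) (c : nat -> nat) :
  \sum_(i < n.+1) c i * m ^ i = c 0 + m * \sum_(i < n) c i.+1 * m ^ i.
Proof.
rewrite big_ord_recl expn0 muln1 big_distrr /=; congr (_ + _).
by apply: eq_bigr => i _; rewrite /bump leq0n add1n expnS mulnCA.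
Qed.

Section Recurrence.

Variables m n : nat.
Hypotheses (m_gt1 : 1 < m) (n_gt0 : 0 < n).

(** Multiplying the parts of [d] by [m] shifts multiplicities up one index; index 0 gets the
    [n - m * j] ones needed to reach [n]. The test [k <= j] guards against [inord k] defaulting to 0
    out of range. *)
Definition add_ones_mult (j : nat) (d : {ffun 'I_j.+1 -> 'I_j.+1}) (i : nat) :=
  if i is k.+1 then if k <= j then val (d (inord k)) else 0 else n - m * j.

Definition add_ones (j : nat) (d : {ffun 'I_j.+1 -> 'I_j.+1}) :
    {ffun 'I_n.+1 -> 'I_n.+1} :=
  [ffun i : 'I_n.+1 => inord (add_ones_mult d i)].

Section Fibre.

Variable j : nat.
Hypothesis mj_le : m * j <= n.

(** Strictness leaves room for the shift: an index [k <= j] moves to [k.+1 <= n]. *)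
Lemma fibre_ltn : j < n.
Proof. by move: mj_le m_gt1 n_gt0; nia. Qed.

Lemma add_onesE (d : {ffun 'I_j.+1 -> 'I_j.+1}) (i : 'I_n.+1) :
  add_ones d i = add_ones_mult d i :> nat.
Proof.
rewrite ffunE inordK // ltnS; case: (val i) => [|k] /=; first exact: leq_subr.
by case: ifP => // _; have := ltn_ord (d (inord k)); have := fibre_ltn; lia.
Qed.

Lemma add_ones_inj : injective (@add_ones j).
Proof.
move=> d e eq_de; apply/ffunP => i; apply: val_inj.
have i_n : i.+1 < n.+1 by have := ltn_ord i; have := fibre_ltn; lia.
have := congr1 (fun c : {ffun 'I_n.+1 -> 'I_n.+1} => val (c (Ordinal i_n))) eq_de.
by rewrite /= !add_onesE /= -ltnS ltn_ord inord_val.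
Qed.

(** The inverse drops the ones and divides the remaining parts by [m], which leaves a partition of
    [j]. *)
Lemma add_ones_image :
  [set @add_ones j d | d in mary_partitions m j] =
  [set c in mary_partitions m n | c ord0 + m * j == n].
Proof.
apply/setP => c; apply/imsetP/idP => [[d + ->]|].
  rewrite !inE => /eqP sum_d.
  rewrite !add_onesE /= subnK // eqxx andbT.
  under eq_bigr do rewrite add_onesE.
  rewrite sum_ord_shift.
  rewrite (big_ord_widen0 (F := fun i => add_ones_mult d i.+1 * m ^ i)
    fibre_ltn) /= => [|i /andP[ji _]].
    under eq_bigr do rewrite -ltnS ltn_ord inord_val.
    by rewrite sum_d subnK.
  by rewrite leqNgt ji.
rewrite !inE => /andP[/eqP sum_c /eqP c0].
pose f i : nat := c (inord i).
have sum_f : \sum_(i < n) f i.+1 * m ^ i = j.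
  have : \sum_(i < n.+1) f i * m ^ i = n.
    by rewrite -[RHS]sum_c; apply: eq_bigr => i _; rewrite /f inord_val.
  have f0 : f 0 = c ord0 by congr (val (c _)); apply: val_inj; rewrite /= inordK.
  rewrite sum_ord_shift f0 -[RHS]c0 => /addnI /eqP.
  by rewrite eqn_pmul2l ?(ltnW m_gt1) // => /eqP.
(* The shifted multiplicities sum to [j], so their support and values are bounded by [j] and fit the
   finite type for [j]. *)
have f_bound i : i < n -> 0 < f i.+1 -> i <= j /\ f i.+1 <= j.
  exact: (@mary_mult_bounded m j n (fun i => f i.+1)).
have f_le i : i < n -> f i.+1 <= j.
  by move=> i_n; case: (posnP (f i.+1)) => [->|/f_bound[]].
exists [ffun i : 'I_j.+1 => inord (f i.+1)].
  rewrite inE; apply/eqP; rewrite -[RHS]sum_f.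
  rewrite (big_ord_widen0 (F := fun i => f i.+1 * m ^ i)
    fibre_ltn) => [|i /andP[ji i_n]].
    apply: eq_bigr => i _; rewrite ffunE inordK // ltnS f_le //.
    by have := ltn_ord i; have := fibre_ltn; lia.
  by case: (posnP (f i.+1)) => [->|/(f_bound _ i_n)[]]; last lia.
apply/ffunP => i; apply: val_inj; rewrite /= add_onesE.
case: i => -[|k] k_n /=.
  by rewrite -[in RHS]c0 addnK; congr (val (c _)); apply: val_inj.
have fk : f k.+1 = c (Ordinal k_n).
  by congr (val (c _)); apply: val_inj; rewrite /= inordK.
rewrite -fk; case: leqP => [kj|jk].
  by rewrite ffunE !inordK // ltnS f_le.
by case: (posnP (f k.+1)) => // /(f_bound _ k_n)[]; lia.
Qed.

Lemma card_fibre :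
  #|[set c in mary_partitions m n | c ord0 + m * j == n]| = mary m j.
Proof. by rewrite -add_ones_image card_imset //; exact: add_ones_inj. Qed.

End Fibre.

Lemma dvdn_large_parts (c : {ffun 'I_n.+1 -> 'I_n.+1}) :
  c \in mary_partitions m n -> exists j, c ord0 + m * j = n.
Proof.
rewrite inE => /eqP sum_c; exists (\sum_(i < n) c (inord i.+1) * m ^ i).
rewrite -[RHS]sum_c.
transitivity (\sum_(i < n.+1) c (inord i) * m ^ i).
  rewrite (sum_ord_shift m n (fun i => c (inord i))); congr (val (c _) + _).
  by apply: val_inj; rewrite /= inordK.
by apply: eq_bigr => i _; rewrite inord_val.
Qed.

(** Partitions of [n] are sorted by [j], the total of the parts other than 1 divided by [m]; each
    fibre is counted by [card_fibre]. *)
Lemma mary_rec_pos : mary m n = \sum_(j < (n %/ m).+1) mary m j.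
Proof.
rewrite /mary -sum1_card.
pose q (c : {ffun 'I_n.+1 -> 'I_n.+1}) : 'I_(n %/ m).+1 :=
  inord ((n - c ord0) %/ m).
rewrite (partition_big q xpredT) //=; apply: eq_bigr => j _.
have mj_le : m * j <= n.
  by rewrite mulnC -leq_divRL ?(ltnW m_gt1) // -ltnS.
rewrite -[RHS](card_fibre mj_le) -sum1_card; apply: eq_bigl => c.
rewrite [RHS]inE; case: (boolP (c \in _)) => //= /dvdn_large_parts[k ck].
rewrite -val_eqE /= inordK; last by rewrite ltnS leq_div2r ?leq_subr.
have -> : n - c ord0 = m * k by rewrite -[X in X - _]ck addKn.
(* With [n] written as [c ord0 + m * k], both membership tests become [k == j]. *)
rewrite mulKn ?(ltnW m_gt1) // -[RHS](congr1 (eq_op _) ck).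
by rewrite eqn_add2l eqn_pmul2l ?(ltnW m_gt1) // eq_sym.
Qed.

End Recurrence.

Lemma mary_rec (m n : nat) :
  1 < m -> mary m n = \sum_(j < (n %/ m).+1) mary m j.
Proof.
case: n => [m1|n m1]; last exact: mary_rec_pos.
by rewrite div0n big_ord1.
Qed.

Section Growth.

Variable m : nat.
Hypothesis m_gt1 : 1 < m.

Lemma leq_mary : {homo mary m : a b / a <= b}.
Proof.
move=> a b ab; rewrite (mary_rec a m_gt1) (mary_rec b m_gt1).
rewrite -!(big_mkord xpredT (mary m)).
rewrite (big_cat_nat (n := (a %/ m).+1) (p := (b %/ m).+1)) ?leq_addr //=.
by rewrite ltnS leq_div2r.
Qed.

Lemma mary_gt0 (n : nat) : 0 < mary m n.
Proof. by rewrite -(mary0 m) leq_mary. Qed.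

Lemma mary_gt1 (n : nat) : m <= n -> 1 < mary m n.
Proof.
move=> /leq_mary; apply: leq_trans.
(* By monotonicity [n = m] suffices, where the recurrence has exactly the terms 0 and 1. *)
rewrite mary_rec // divnn (ltnW m_gt1) big_ord_recl big_ord1.
by rewrite (leq_add (mary_gt0 _) (mary_gt0 _)).
Qed.

(** Terms of index at least [m] contribute 2 or more, the others at least 1. Adding [m] on the right
    avoids truncated subtraction. *)
Lemma mary_lower_bound (a : nat) : (a %/ m).+1.*2 <= mary m a + m.
Proof.
rewrite mary_rec //; elim: (a %/ m).+1 => [|k IHk]; first by [].
rewrite big_ord_recr /=.
case: (leqP m k) => [/mary_gt1 gt1|k_m].
  by rewrite doubleS -addn2 addnAC leq_add.
(* Here all [k.+1 <= m] terms are at least 1, and [m] supplies the second [k.+1]. *)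
have : k <= \sum_(i < k) mary m i.
  rewrite -[leqLHS]card_ord -sum1_card; apply: leq_sum => i _.
  exact: mary_gt0.
move=> k_le; rewrite doubleS -addnn -addSn -addnS.
by rewrite leq_add // -addn1 leq_add // mary_gt0.
Qed.

Lemma mary_add_upper_bound (a b : nat) :
  a <= b -> mary m (a + b) <= (a %/ m).+2 * mary m b.
Proof.
move=> ab; rewrite (mary_rec (a + b) m_gt1).
(* Since [a <= b] and [m >= 2], [a + b <= m * b]. *)
have le_b : (a + b) %/ m <= b.
  by rewrite -ltnS ltn_divLR ?(ltnW m_gt1) //; nia.
(* The carry of the remainders adds at most 1. *)
have le_q : (a + b) %/ m <= a %/ m + b %/ m + 1.
  by rewrite divnD ?(ltnW m_gt1) // leq_add2l leq_b1.
rewrite -(big_mkord xpredT (mary m)).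
rewrite (big_cat_nat (n := (b %/ m).+1)) //=; last by rewrite ltnS leq_div2r ?leq_addl.
rewrite big_mkord -mary_rec // mulSn leq_add2l.
apply: (@leq_trans (\sum_((b %/ m).+1 <= i < ((a + b) %/ m).+1) mary m b)).
  rewrite big_nat [leqRHS]big_nat; apply: leq_sum => i /andP[_ i_le].
  by apply: leq_mary; lia.
rewrite sum_nat_const_nat subSS leq_mul2r leq_subLR.
by rewrite addnS -addn1 [b %/ m + _]addnC le_q orbT.
Qed.

Lemma mary_mul_gt_le (a b : nat) :
  m * m.+1 <= a -> a <= b -> mary m (a + b) < mary m a * mary m b.
Proof.
move=> a_large /mary_add_upper_bound /leq_ltn_trans; apply.
rewrite ltn_pmul2r ?mary_gt0 //.
(* For [q = a %/ m], the bound [2 * (q + 1) - m] exceeds [q + 2] exactly when [q > m]. *)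
have : m.+1 <= a %/ m by rewrite leq_divRL ?(ltnW m_gt1) // mulnC.
by have := mary_lower_bound a; lia.
Qed.

End Growth.

Theorem theorem4p8 (m : nat) (hm : 2 <= m) :
  exists N : nat, forall a b : nat, N <= a -> N <= b ->
    mary m a * mary m b > mary m (a + b).
Proof.
exists (m * m.+1) => a b a_large b_large.
case: (leqP a b) => [ab|/ltnW ba]; first exact: mary_mul_gt_le.
by rewrite addnC mulnC; exact: mary_mul_gt_le.
Qed.
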